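(* Let $c_{-1},c_0,c_1,c_2,c_3>0$ and $\kappa,\rho>1$. Given any initial value $Y_0=X_0>0$, and for any step-size $h=\tfrac{T}{N}>0$, the scheme $$Y_{n+1}=Y_n+c_{-1}Y_{n+1}^{-1}h+\big(-c_0+c_1Y_n+f_h(Y_n)\big)h+g_h(Y_n)\,\Delta W_n,\qquad n=0,1,\dots,N-1,$$ admits unique, positive numerical solutions $\{Y_n\}$; that is, there is exactly one sequence $\{Y_n\}_{0\le n\le N}$ with values in $(0,\infty)$, starting from the given $Y_0$, that satisfies the recursion. In other words, the scheme is positivity preserving unconditionally.
   Context: $T\in(0,\infty)$, $N\in\mathbb{N}$, $h=T/N$, $t_n=nh$ for $n=0,\dots,N$. $\{W_t\}_{t\ge 0}$ is a standard real Brownian motion on a complete filtered probability space and $\Delta W_n:=W_{t_{n+1}}-W_{t_n}$. The functions $f_h,g_h:(0,+\infty)\to\mathbb{R}$ are real-valued modifications (depending on $h$) of $f(x):=-c_2x^{\kappa}$ and $g(x):=c_3x^{\rho}$ respectively; no quantitative property of $f_h,g_h$ is assumed in this statement. The scheme is implicit in $Y_{n+1}$ only through the term $c_{-1}Y_{n+1}^{-1}h$; it approximates the generalized Aït-Sahalia model $\mathrm{d}X_t=(c_{-1}X_t^{-1}-c_0+c_1X_t-c_2X_t^{\kappa})\,\mathrm{d}t+c_3X_t^{\rho}\,\mathrm{d}W_t$, $X_0=x_0>0$. *)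

(* Defs.v *)
From HB Require Import structures.
From mathcomp Require Import all_boot all_order all_algebra.
From mathcomp Require Import all_classical all_reals all_analysis.
Set Implicit Arguments.
Unset Strict Implicit.
Unset Printing Implicit Defensive.
Import Order.TTheory GRing.Theory Num.Theory.
Import numFieldNormedType.Exports.
Local Open Scope classical_set_scope.
Local Open Scope ring_scope.

(* Processes and filtrations are indexed by R; only times t >= 0 matter. *)

Record complete_filtration (d : measure_display) (Omega : measurableType d)
    (R : realType) (P : probability Omega R) (F : R -> set (set Omega)) : Prop :=
  CompleteFiltration {
    filtration_sigma_algebra : forall t : R, 0 <= t -> sigma_algebra setT (F t);
    filtration_measurable : forall t : R, 0 <= t -> F t `<=` measurable;
    filtration_nondecreasing : forall s t : R, 0 <= s -> s <= t -> F s `<=` F t;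
    filtration_complete_measure : measure_is_complete P;
    filtration_negligible : P.-negligible `<=` F 0 }.

Definition increment (Omega : Type) (R : realType) (W : R -> Omega -> R)
    (s t : R) (w : Omega) : R := W t w - W s w.

Record brownian_motion (d : measure_display) (Omega : measurableType d)
    (R : realType) (P : probability Omega R) (F : R -> set (set Omega))
    (W : R -> Omega -> R) : Prop :=
  BrownianMotion {
    brownian_adapted : forall t : R, 0 <= t ->
      forall B : set R, measurable B -> F t (W t @^-1` B);
    brownian_start : {ae P, forall w, W 0 w = 0};
    brownian_continuous :
      {ae P, forall w, {within [set t : R | 0 <= t], continuous (W ^~ w)}};
    brownian_independent : forall s t : R, 0 <= s -> s < t ->
      forall (A : set Omega) (B : set R), F s A -> measurable B ->
      P (A `&` increment W s t @^-1` B) =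
        (P A * P (increment W s t @^-1` B))%E;
    (* the second parameter of [normal_prob] is the standard deviation *)
    brownian_normal : forall s t : R, 0 <= s -> s < t ->
      forall B : set R, measurable B ->
      P (increment W s t @^-1` B) = normal_prob 0 (Num.sqrt (t - s)) B }.

(* [cm1] is the coefficient c_{-1}; [fh] and [gh] are the modified
   coefficients f_h and g_h, of which only the values on (0, +oo) are used when
   Y is positive; [dW n] is the n-th noise increment. *)
Definition semi_implicit_scheme (R : realType) (N : nat) (h cm1 c0 c1 : R)
    (fh gh : R -> R) (dW : nat -> R) (Y : 'I_N.+1 -> R) : Prop :=
  forall n : nat, (n < N)%N ->
    Y (inord n.+1) = Y (inord n) + cm1 * (Y (inord n.+1))^-1 * h
      + (- c0 + c1 * Y (inord n) + fh (Y (inord n))) * h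
      + gh (Y (inord n)) * dW n.

(* Main.v *)
Require Import Defs.
From HB Require Import structures.
From mathcomp Require Import all_boot all_order all_algebra.
From mathcomp Require Import all_classical all_reals all_analysis.
From mathcomp Require Import ring lra.
Import Order.TTheory GRing.Theory Num.Theory.
Import numFieldNormedType.Exports.
Local Open Scope classical_set_scope.
Local Open Scope ring_scope.

(** The argument is pathwise and deterministic. Once [Y_n] and the noise
    increment are known, one step of the scheme reads [x = b + a / x] with
    [a = c_{-1} h > 0] and [b] an explicit real number. Multiplying by [x], this
    is the quadratic equation [x^2 - b x - a = 0], whose roots have product
    [- a < 0]: whatever the sign and the size of [b], it has exactly one
    positive root, [pos_root a b] (lemma [pos_rootP]). Hence no bound on the
    step size, on the modified coefficients or on the noise is needed: the
    scheme is equivalent, among positive sequences, to the explicit recursion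
    [Y_{n+1} = pos_root a b], and induction on [n] gives existence and
    uniqueness. *)

(** For [0 < a], the unique positive root of [x^2 - b x - a]. *)
Definition pos_root {R : rcfType} (a b : R) : R :=
  (b + Num.sqrt (b ^+ 2 + 4 * a)) / 2.

Lemma pos_root_gt0 {R : rcfType} (a b : R) : 0 < a -> 0 < pos_root a b.
Proof.
move=> a0; rewrite /pos_root divr_gt0 //.
have : `|b| < Num.sqrt (b ^+ 2 + 4 * a).
  by rewrite -sqrtr_sqr ltr_sqrt ?ltrDl ?mulr_gt0// ltr_wpDl ?sqr_ge0// mulr_gt0.
by rewrite ltr_norml => /andP[]; lra.
Qed.

Lemma pos_rootP {R : rcfType} (a b x : R) : 0 < a -> 0 < x ->
  x = b + a / x <-> x = pos_root a b.
Proof.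
move=> a0 x0; have xn0 : x != 0 by rewrite gt_eqF.
have quad : x = b + a / x <-> x ^+ 2 = b * x + a.
  split=> [e|e]; first by rewrite expr2 {1}e mulrDl divfK.
  by apply: (mulIf xn0); rewrite mulrDl divfK// -e.
rewrite quad; split=> [e|xE].
  (* [2 x - b = x + a / x] is the positive square root of the discriminant. *)
  have pos : 0 <= 2 * x - b.
    have := divr_gt0 a0 x0; have := quad.2 e; lra.
  rewrite /pos_root (_ : b ^+ 2 + 4 * a = (2 * x - b) ^+ 2); last first.
    by rewrite sqrrB exprMn e; ring.
  by rewrite sqrtr_sqr ger0_norm//; field.
have : Num.sqrt (b ^+ 2 + 4 * a) ^+ 2 = b ^+ 2 + 4 * a.
  by rewrite sqr_sqrtr// addr_ge0 ?sqr_ge0// mulr_ge0// ltW.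
have -> : Num.sqrt (b ^+ 2 + 4 * a) = 2 * x - b by rewrite xE /pos_root; field.
by rewrite sqrrB exprMn; lra.
Qed.

(** The explicit form of the scheme: [b n y] collects the terms that depend
    only on the current value [y]. *)
Fixpoint pos_root_seq {R : rcfType} (a : R) (b : nat -> R -> R) (x0 : R)
    (n : nat) : R :=
  if n is m.+1 then
    let y := pos_root_seq a b x0 m in pos_root a (b m y)
  else x0.

Lemma pos_root_seq_gt0 {R : rcfType} (a : R) (b : nat -> R -> R) (x0 : R)
    (n : nat) : 0 < a -> 0 < x0 -> 0 < pos_root_seq a b x0 n.
Proof. by move=> a0 x00; case: n => [//|n]; exact: pos_root_gt0. Qed.

(** Positive solutions of the implicit scheme are exactly those of the explicit
    recursion; this holds for any coefficients and any noise. *)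
Lemma semi_implicit_schemeP {R : realType} {N : nat} (h cm1 c0 c1 : R)
    (fh gh : R -> R) (dW : nat -> R) (Y : 'I_N.+1 -> R) :
  0 < cm1 * h -> (forall n, 0 < Y n) ->
  let b n y := y + (- c0 + c1 * y + fh y) * h + gh y * dW n in
  semi_implicit_scheme h cm1 c0 c1 fh gh dW Y <->
  forall n : 'I_N.+1, Y n = pos_root_seq (cm1 * h) b (Y ord0) n.
Proof.
move=> a0 Y0 b.
have step n : Y (inord n.+1) = Y (inord n) + cm1 * (Y (inord n.+1))^-1 * h
      + (- c0 + c1 * Y (inord n) + fh (Y (inord n))) * h
      + gh (Y (inord n)) * dW n <->
    Y (inord n.+1) = pos_root (cm1 * h) (b n (Y (inord n))).
  rewrite -pos_rootP// /b.
  by rewrite [cm1 * _ * h]mulrAC -!addrA [_ / _ + _]addrC !addrA.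
split=> [Ysch [n nN]|Yexp n nN].
  rewrite (_ : Ordinal nN = inord n); last by apply/val_inj; rewrite /= inordK.
  rewrite inordK//; elim: n nN => [|n IHn] nN /=.
    by congr (Y _); apply/val_inj; rewrite /= inordK.
  by rewrite -(IHn (ltnW nN)); apply/step/Ysch.
by apply/step; rewrite (Yexp (inord n.+1)) (Yexp (inord n)) !inordK// ltnW.
Qed.

Theorem lemma3p1 (R : realType)
    (d : measure_display) (Omega : measurableType d) (P : probability Omega R)
    (F : R -> set (set Omega)) (hF : complete_filtration P F)
    (W : R -> Omega -> R) (hW : brownian_motion P F W)
    (cm1 c0 c1 c2 c3 kappa rho : R)
    (hcm1 : 0 < cm1) (hc0 : 0 < c0) (hc1 : 0 < c1) (hc2 : 0 < c2) (hc3 : 0 < c3)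
    (hkappa : 1 < kappa) (hrho : 1 < rho)
    (* f_ h and g_ h : the modifications, for step-size h, of
       x |-> - c2 * x `^ kappa and x |-> c3 * x `^ rho *)
    (f_ g_ : R -> R -> R)
    (T : R) (hT : 0 < T) (N : nat) (hN : (0 < N)%N)
    (h : R) (hh : h = T / N%:R)
    (X0 : R) (hX0 : 0 < X0) :
  forall w : Omega, exists! Y : 'I_N.+1 -> R,
    [/\ forall n, 0 < Y n,
        Y ord0 = X0 &
        semi_implicit_scheme h cm1 c0 c1 (f_ h) (g_ h)
          (fun n => increment W (n%:R * h) (n.+1%:R * h) w) Y].
Proof.
move=> w.
have a0 : 0 < cm1 * h by rewrite mulr_gt0// hh divr_gt0// ltr0n.
set dW := fun n : nat => _.
pose b n y := y + (- c0 + c1 * y + f_ h y) * h + g_ h y * dW n.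
exists (fun n => pos_root_seq (cm1 * h) b X0 n); split.
  have Y0 (n : 'I_N.+1) : 0 < pos_root_seq (cm1 * h) b X0 n.
    exact: pos_root_seq_gt0.
  by split=> //; apply/semi_implicit_schemeP.
move=> Y [Ypos Y0 /(semi_implicit_schemeP _ _ _ _ _ _ _ _ a0 Ypos) Yexp].
by apply/funext => n; rewrite Yexp Y0.
Qed.
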